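(* Let $(X,\tau)$ be a topological space that is a Menger space, and let $\mathcal{U}_1\supseteq\mathcal{U}_2\supseteq\cdots$ be countable point-infinite open covers of $X$, each having no finite subcover. Let $k\in\mathbb{N}$, and let $\chi_1\colon\tau\to\{1,\dots,k\}$ and $\chi_2\colon[\tau]^2\to\{1,\dots,k\}$ be arbitrary finite colorings of the sets $\tau$ and $[\tau]^2$. Then there are nonempty, pairwise disjoint, finite sets $\mathcal{F}_1\subseteq\mathcal{U}_1,\ \mathcal{F}_2\subseteq\mathcal{U}_2,\dots$ such that the sets $V_n:=\bigcup\mathcal{F}_n$, for $n\in\mathbb{N}$, have the following properties: (1) The family $\{V_1,V_2,\dots\}$ is a point-infinite cover of $X$. (2) For all nonempty finite sets $F<H$ of natural numbers, the sets $\bigcup_{n\in F}V_n$ and $\bigcup_{n\in H}V_n$ are distinct. (3) All sets $\bigcup_{n\in F}V_n$, for nonempty finite sets $F\subseteq\mathbb{N}$, have the same color (under $\chi_1$). (4) All sets $\{\bigcup_{n\in F}V_n,\ \bigcup_{n\in H}V_n\}$, for nonempty finite sets $F<H$ of natural numbers, have the same color (under $\chi_2$). Moreover, if $\mathcal{U}_1=\{U_1,U_2,\dots\}$ is enumerated without repetitions, the sets $\mathcal{F}_n$ may be chosen so that, in addition, the sets $F_n:=\{m\in\mathbb{N}: U_m\in\mathcal{F}_n\}$ satisfy $F_1<F_2<\cdots$.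
   Context: A topological space $X$ is a Menger space if, for each sequence $\mathcal{U}_1,\mathcal{U}_2,\dots$ of countable open covers of $X$, there are finite sets $\mathcal{F}_1\subseteq\mathcal{U}_1,\mathcal{F}_2\subseteq\mathcal{U}_2,\dots$ such that the sets $\bigcup\mathcal{F}_1,\bigcup\mathcal{F}_2,\dots$ form an open cover of $X$ (Menger's property is restricted to countable covers). A cover of $X$ is point-infinite if every point of $X$ is contained in infinitely many members of the cover. For a set $T$, $[T]^2$ is the set of all 2-element subsets of $T$. For nonempty finite sets $F,H\subseteq\mathbb{N}$, $F<H$ means that every element of $F$ is smaller than every element of $H$. The common color in (3) and the common color in (4) need not be equal. *)

(* Defs.v *)
From mathcomp Require Import all_boot all_order.
From mathcomp Require Import all_classical topology.

Set Implicit Arguments.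
Unset Strict Implicit.
Unset Printing Implicit Defensive.

Local Open Scope classical_set_scope.
Local Open Scope card_scope.

Definition open_cover (X : topologicalType) (U : set (set X)) : Prop :=
  U `<=` open /\ \bigcup_(A in U) A = setT.

Definition point_infinite (X : topologicalType) (U : set (set X)) : Prop :=
  forall x : X, infinite_set [set A | U A /\ A x].

Definition has_finite_subcover (X : topologicalType) (U : set (set X)) : Prop :=
  exists F : set (set X),
    [/\ finite_set F, F `<=` U & \bigcup_(A in F) A = setT].

(* Only countable covers are considered, so that no Lindelof-type assumption is
   hidden in the property. *)
Definition menger_space (X : topologicalType) : Prop :=
  forall U : nat -> set (set X),
    (forall n, countable (U n) /\ open_cover (U n)) ->
    exists FF : nat -> set (set X),
      (forall n, finite_set (FF n) /\ FF n `<=` U n) /\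
      open_cover (range (fun n => \bigcup_(A in FF n) A)).

(* [S]^2 *)
Definition two_subsets (T : Type) (S : set T) : set (set T) :=
  [set P | P `<=` S /\ P #= `I_2].

(* A coloring of S with colors {1, ..., k} is a total function whose values
   outside S are unconstrained and irrelevant. *)
Definition coloring (T : Type) (k : nat) (S : set T) (chi : T -> nat) : Prop :=
  forall x, S x -> (1 <= chi x <= k)%N.

Definition nonempty_finite (F : set nat) : Prop := F !=set0 /\ finite_set F.

(* F < H *)
Definition set_lt (F H : set nat) : Prop :=
  forall i j, F i -> H j -> (i < j)%N.

(* Sequences are indexed from 0: FF n and U n stand for the (n+1)-st terms. *)
Definition finite_selection (X : topologicalType) (U FF : nat -> set (set X)) :
    Prop :=
  (forall n, [/\ FF n !=set0, finite_set (FF n) & FF n `<=` U n]) /\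
  (forall m n, m <> n -> FF m `&` FF n = set0).

Definition ramsey_properties (X : topologicalType)
    (chi1 : set X -> nat) (chi2 : set (set X) -> nat) (V : nat -> set X) :
    Prop :=
  [/\ open_cover (range V) /\ point_infinite (range V),
      forall F H, nonempty_finite F -> nonempty_finite H -> set_lt F H ->
        \bigcup_(n in F) V n <> \bigcup_(n in H) V n,
      exists c : nat, forall F, nonempty_finite F ->
        chi1 (\bigcup_(n in F) V n) = c &
      exists c : nat, forall F H,
        nonempty_finite F -> nonempty_finite H -> set_lt F H ->
        chi2 [set \bigcup_(n in F) V n; \bigcup_(n in H) V n] = c].

(* Main.v *)
Require Import Defs.
From mathcomp Require Import all_boot all_order.
From mathcomp Require Import all_classical topology.

(** Enumerate the first cover as u 0, u 1, ... and write V F for the union of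
    the u i with i in F ([open_union]). The sets F_n sought are blocks
    F_0 < F_1 < ... of natural numbers, V turns unions of blocks into unions of
    open sets, and the two colorings pull back to the semigroup of sets of
    naturals under union.
    Two requirements compete: Ramsey theory must leave freedom in the choice of
    each block, and the blocks must cover every point infinitely often.

    Ramsey side. Let p be an idempotent ultrafilter on this semigroup. The
    Galvin-Glazer argument builds block sequences all of whose finite unions,
    and pairs of successive finite unions, are monochromatic, by picking each
    block in a member of p. Since there are only finitely many subsets of
    [0, n), that member can be made to depend on nothing but a bound n for the
    blocks already chosen ([block], [block_mem], [block_unions],
    [block_unions2]).

    Covering side. A single block must do the work of a finite union, yet
    finite unions of members of a set in p need not be in this set. So p is
    chosen among the ultrafilters all of whose members are large, where B is
    large if for some N it has members containing every window
    {i | N <= i <= m, u i in the N-th cover}. Largeness is a partition regular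
    notion and survives products, so these ultrafilters form a closed
    subsemigroup ([colarge_additive]), and Ellis' theorem, proved here for
    filters instead of closed sets ([ex_idempotent_ultrafilter]), yields p. As
    m grows the unions V of the windows increase to the whole space, because
    the covers are point-infinite.

    It remains to choose the right ends m of the windows. The left end of the
    next window depends on the previous choices, so this is a play of the
    Menger game against a given strategy. Windows shrink when their left end
    moves right, and the next left end is bounded by a function of the last
    right end only; under these circumstances a direct application of Menger's
    property to iterated reaching times gives right ends, fixed in advance up
    to being increased, that win against the strategy ([menger_right_ends]).

    Distinctness of the unions comes for free: equality of the two unions is
    treated as an additional color 0 of pairs. Were 0 the common color, all
    the sets V F_n would be equal, hence equal to the whole space, and the
    finite set F_0 would provide a finite subcover. *)

Local Open Scope classical_set_scope.

Set Implicit Arguments.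
Unset Strict Implicit.

(** * Idempotent ultrafilters in a semigroup *)

Section Idempotent.
Context {S : Type} (op : S -> S -> S).
Hypothesis opA : associative op.

(** On ultrafilters this is the product of the Stone-Cech compactification. When
    G is an ultrafilter and F stands for the closed set T of the ultrafilters
    extending it, the product stands for T G. *)
Definition filter_mul (F G : set_system S) : set_system S :=
  [set A | F [set s | G (op s @^-1` A)]].

(** A filter F stands for the closed set of the ultrafilters that extend it;
    this condition says that this closed set is a subsemigroup. *)
Definition additive_filter (F : set_system S) : Prop :=
  ProperFilter F /\
  forall G : set_system S, UltraFilter G -> F `<=` G -> F `<=` filter_mul F G.

Lemma ultraC (G : set_system S) (A : set S) :
  UltraFilter G -> ~ G A -> G (~` A).
Proof. by move=> GU; case: (in_ultra_setVsetC A GU). Qed.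

Lemma ultraNC (G : set_system S) (A : set S) :
  ProperFilter G -> G A -> ~ G (~` A).
Proof.
move=> GU GA GnA; apply: (@filter_not_empty _ G).
by rewrite -(setICr A); exact: filterI.
Qed.

Lemma filter_mul_proper (F G : set_system S) :
  ProperFilter F -> ProperFilter G -> ProperFilter (filter_mul F G).
Proof.
move=> FF GG; apply: Build_ProperFilter_ex.
  move=> A FGA; have [s /= Gs] := @filter_ex _ F _ _ FGA.
  by have [t] := @filter_ex _ G _ _ Gs; exists (op s t).
split.
- by apply: (@filterS _ F) (@filterT _ F _) => s _; exact: filterT.
- move=> A B FA FB; apply: (@filterS _ F) (@filterI _ F _ _ _ FA FB).
  by move=> s [sA sB]; exact: (@filterI _ G).
- move=> A B AB; apply: (@filterS _ F) => s; apply: (@filterS _ G) => t.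
  exact: AB.
Qed.

Lemma filter_mulA (F G H : set_system S) :
  filter_mul F (filter_mul G H) = filter_mul (filter_mul F G) H.
Proof.
apply: funext => A; rewrite /filter_mul /=; congr F; apply: funext => s /=.
congr G; apply: funext => t /=; congr H; apply: funext => v /=.
by rewrite opA.
Qed.

Lemma filter_mul_ultra_eq (F G H : set_system S) : UltraFilter G ->
  ProperFilter F -> ProperFilter H -> G `<=` filter_mul F H -> filter_mul F H = G.
Proof. by move=> GU FF HH /max_filter; apply; exact: filter_mul_proper. Qed.

(** Intersection of the two closed sets of ultrafilters. *)
Definition filter_join (F G : set_system S) : set_system S :=
  [set D | exists A B, [/\ F A, G B & A `&` B `<=` D]].

Lemma filter_join_proper (F G : set_system S) : ProperFilter F -> Filter G ->
  (forall A B, F A -> G B -> ~ (A `<=` ~` B)) -> ProperFilter (filter_join F G).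
Proof.
move=> FF GG FG; split.
  move=> [A [B [FA GB AB]]]; apply: (FG A B) => // s As Bs; exact: (AB s).
split.
- exists setT, setT; split => //; exact: filterT.
- move=> P Q [A [B [FA GB AB]]] [C [D [FC GD CD]]].
  exists (A `&` C), (B `&` D); split; [exact: filterI|exact: filterI|].
  by move=> s [[As Cs] [Bs Ds]]; split; [exact: AB|exact: CD].
- move=> P Q PQ [A [B [FA GB AB]]]; exists A, B; split => //.
  exact: subset_trans AB PQ.
Qed.

Lemma filter_join_left (F G : set_system S) : Filter G -> F `<=` filter_join F G.
Proof. by move=> GG A FA; exists A, setT; split=> //; exact: filterT. Qed.
Lemma filter_join_right (F G : set_system S) : Filter F -> G `<=` filter_join F G.
Proof. by move=> GG A FA; exists setT, A; split=> //; exact: filterT. Qed.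

(** The ultrafilters q extending this filter are those for which the product
    of q and U extends G. *)
Definition divisor_filter (G U : set_system S) : set_system S :=
  [set D | exists2 A, G A & [set s | U (op s @^-1` A)] `<=` D].

Lemma divisor_filter_filter (G U : set_system S) :
  Filter G -> Filter U -> Filter (divisor_filter G U).
Proof.
move=> GG UU; split.
- exists setT; [exact: filterT|by []].
- move=> P Q [A GA AP] [B GB BQ]; exists (A `&` B); first exact: filterI.
  move=> s /= sAB; split; [apply: AP|apply: BQ] => /=;
    by apply: (@filterS _ U) sAB => t [].
- by move=> P Q PQ [A GA AP]; exists A => //; exact: subset_trans AP PQ.
Qed.

(** Right multiplication by an ultrafilter U maps closed sets to closed sets:
    an ultrafilter G extending the product of F and U is itself a product H U
    with H extending F, namely for every ultrafilter H extending the filter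
    below. If that filter were improper, the complement of some member C of G
    would be in the product of F and U, since U decides s^-1 C for each s. *)
Lemma filter_join_divisor_proper (F G U : set_system S) :
  ProperFilter F -> ProperFilter G -> UltraFilter U ->
  filter_mul F U `<=` G -> ProperFilter (filter_join F (divisor_filter G U)).
Proof.
move=> FF GG UU FUG; apply: filter_join_proper; first exact: divisor_filter_filter.
move=> A B FA [C GC CB] AB; apply: (@ultraNC G C _ GC); apply: FUG.
apply: (@filterS _ F) FA => s /AB Bs.
by apply: ultraC => UC; apply: Bs; exact: CB.
Qed.

(** If T is a closed subsemigroup and U is in T, then so is T U, since
    (T U)(T U) = (T U T) U is contained in T U. *)
Lemma additive_filter_mul (F U : set_system S) : additive_filter F ->
  UltraFilter U -> F `<=` U -> additive_filter (filter_mul F U).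
Proof.
move=> [FF addF] UU FU; split; first exact: filter_mul_proper.
move=> G GU FUG A FUA.
have [H [HU JH]] := ultraFilterLemma (filter_join_divisor_proper FF _ UU FUG).
have FH : F `<=` H
  by apply: subset_trans JH; apply: filter_join_left; exact: divisor_filter_filter.
have HG : filter_mul H U = G.
  apply: filter_mul_ultra_eq => B GB; apply: JH; apply: filter_join_right; exists B => //.
have : filter_mul (filter_mul F H) U A by exact: (addF H).
by rewrite -filter_mulA HG => /(addF U UU FU).
Qed.

(** Larger filters are smaller closed sets: this is the existence of a minimal
    closed subsemigroup. *)
Lemma ex_maximal_additive (F0 : set_system S) : additive_filter F0 ->
  exists F, [/\ additive_filter F, F0 `<=` F &
    forall G, additive_filter G -> F `<=` G -> G = F].
Proof.
move=> addF0.
have [|A [addA maxA]] :=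
  (* Joining F0 to every candidate makes the empty chain harmless. *)
  @Zorn_bigcup (set S) [set A | additive_filter (F0 `|` A)].
  move=> C Cadd Ctot /=.
  have [[A0 CA0]|C0] := pselect (C !=set0); last first.
    suff -> : \bigcup_(X in C) X = set0 by rewrite setU0.
    by rewrite -subset0 => P [X CX _]; apply: C0; exists X.
  have -> : F0 `|` \bigcup_(X in C) X = \bigcup_(X in C) (F0 `|` X).
    apply/seteqP; split => [P [F0P|[X CX XP]]|P [X CX [F0P|XP]]].
    - by exists A0 => //; left.
    - by exists X => //; right.
    - by left.
    - by right; exists X.
  split.
    split; last split.
    - by move=> [X CX]; have [XX _] := Cadd _ CX; exact: (@filter_not_empty _ _ XX).
    - by exists A0 => //; have [XX _] := Cadd _ CA0; exact: (@filterT _ _ XX).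
    - move=> P Q [X CX XP] [Y CY YQ].
      have [XY|YX] := Ctot _ _ CX CY.
      + exists Y => //; have [YY _] := Cadd _ CY; apply: (@filterI _ _ YY) => //.
        by case: XP => [|/XY]; [left|right].
      + exists X => //; have [XX _] := Cadd _ CX; apply: (@filterI _ _ XX) => //.
        by case: YQ => [|/YX]; [left|right].
    - move=> P Q PQ [X CX XP]; exists X => //; have [XX _] := Cadd _ CX.
      exact: (@filterS _ _ XX _ _ PQ).
  move=> G GU CG P [X CX XP]; have [XX addX] := Cadd _ CX.
  have XG : F0 `|` X `<=` G by apply: subset_trans CG; exact: bigcup_sup.
  by exists X => //; exact: addX XP.
exists (F0 `|` A); split => // G addG F0AG.
have F0G : F0 `|` G = G by rewrite setUidr // => P ?; apply: F0AG; left.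
apply/seteqP; split => // P GP; apply: contrapT => nP.
apply: (maxA G); last by rewrite /= F0G.
split; first by move=> Q AQ; apply: F0AG; right.
by move=> GA; apply: nP; right; exact: GA.
Qed.

(** Ellis' theorem. In a minimal closed subsemigroup T, take any U. Then T U is
    a closed subsemigroup of T, so T U = T; hence the set of all q in T with
    q U = U is nonempty, and it is again a closed subsemigroup, so it is T and
    U U = U. *)
Theorem ex_idempotent_ultrafilter (F0 : set_system S) : additive_filter F0 ->
  exists p, [/\ UltraFilter p, F0 `<=` p & p `<=` filter_mul p p].
Proof.
move=> /ex_maximal_additive[F [addF F0F maxF]].
have [FF _] := addF.
have [U [UU FU]] := ultraFilterLemma FF.
exists U; split => //; first exact: subset_trans FU.
have FUF : filter_mul F U = F.
  by apply: maxF; [exact: additive_filter_mul|case: addF => _; exact].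
have EP : ProperFilter (filter_join F (divisor_filter U U)).
  by apply: filter_join_divisor_proper; rewrite ?FUF.
suff EF : filter_join F (divisor_filter U U) = F.
  by move=> A UA; apply: FU; rewrite -EF; apply: filter_join_right; exists A.
apply: maxF; last by apply: filter_join_left; exact: divisor_filter_filter.
split => // G GU EG.
have FG : F `<=` G
  by apply: subset_trans EG; apply: filter_join_left; exact: divisor_filter_filter.
have GUU : filter_mul G U = U.
  by apply: filter_mul_ultra_eq => B UB; apply: EG; apply: filter_join_right; exists B.
have CP : ProperFilter (filter_mul (filter_join F (divisor_filter U U)) G)
  by exact: filter_mul_proper.
move=> D [A [B [FA [C UC CB] ABD]]]; apply: filterS ABD _; apply: filterI.
  apply: filter_join_left; first exact: divisor_filter_filter.
  by have [_ /(_ G GU FG _ FA)] := addF.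
apply: filterS CB _; apply: filter_join_right; exists C => // s /=.
have -> : op s @^-1` [set t | U (op t @^-1` C)] =
          [set t | U (op t @^-1` (op s @^-1` C))].
  apply: funext => t /=; congr U; apply: funext => v /=; by rewrite opA.
by rewrite -[G _]/(filter_mul G U _) GUU.
Qed.

End Idempotent.

(** * Blocks with monochromatic finite unions *)

Lemma finite_set_nat_bound (E : set nat) : finite_set E -> exists n, E `<=` `I_n.
Proof.
move=> /finite_fsetP[D ->]; exists (\max_(i <- finmap.enum_fset D) i).+1 => i /= iD.
by rewrite ltnS; apply: (@leq_bigmax_seq _ _ predT id).
Qed.

Section Blocks.
Variables (p : set_system (set nat)).
Hypotheses (pU : UltraFilter p) (pI : p `<=` filter_mul setU p p).

(** If Q is in p, so is [star Q], and the members d of [star Q] can be continued: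
    the translate of [star Q] by d is in p as well. *)
Definition star (Q : set (set nat)) : set (set nat) :=
  [set d | Q d /\ p (setU d @^-1` Q)].

Lemma star_in_ultra (Q : set (set nat)) : p Q -> p (star Q).
Proof. by move=> pQ; apply: filterI => //; exact: pI. Qed.

Lemma star_shift (Q : set (set nat)) d : star Q d -> p (setU d @^-1` star Q).
Proof.
move=> [_ dQ]; apply: filterS (star_in_ultra dQ) => H [QH dHQ]; split => //.
by apply: (@filterS _ p) dHQ => G; rewrite /preimage /= setUA.
Qed.

(** The set of all c below n is finite; this is what lets the choice of the
    next block depend on a bound only. *)
Lemma filter_forall_subset (T : Type) (G : set_system T) n
    (Q : set nat -> set T) : Filter G ->
  (forall c, c `<=` `I_n -> G (Q c)) ->
  G [set t | forall c, c `<=` `I_n -> Q c t].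
Proof.
move=> GF; elim: n Q => [|n IHn] Q GQ.
  apply: filterS (GQ set0 (@sub0set _ _)) => t Q0 c.
  by rewrite II0 subset0 => ->.
have IS : `I_n `<=` `I_n.+1 by move=> i /= /ltnW.
have : G [set t | forall c, c `<=` `I_n -> (Q c `&` Q (c `|` [set n])) t].
  apply: IHn => c cn; apply: filterI; apply: GQ.
    exact: subset_trans IS.
  by move=> i [/cn/IS//|->/=].
apply: filterS => t Qt c cn; have cn' : c `\ n `<=` `I_n.
  by move=> i [/cn /=]; rewrite ltnS leq_eqVlt => /predU1P[].
have [nc|nc] := pselect (c n); last first.
  by have [+ _] := Qt _ cn'; rewrite not_setD1.
by have [_] := Qt _ cn'; rewrite setUC setD1K.
Qed.

Variables (A : set (set nat)) (R : set nat -> set (set nat)).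
Hypotheses (pA : p A) (pR : forall c, A c -> p (R c)).

(** The choices for a block, when n bounds all elements of the earlier blocks:
    c is the union of some of these, and H must be usable both as a continuation
    of c and as a part of a later union that is paired with c. In the last case
    d is the part of this later union that precedes H. *)
Definition block (n : nat) : set (set nat) :=
  [set H | star A H /\ forall c, c `<=` `I_n -> star A c ->
     [/\ star A (c `|` H), star (R c) H &
         forall d, d `<=` `I_n -> star (R c) d -> star (R c) (d `|` H)]].

Lemma block_mem n : p (block n).
Proof.
apply: filterI; first exact: star_in_ultra.
apply: filter_forall_subset => c _.
have [Ac|nAc] := pselect (star A c); last by apply: filterS filterT.
have cR : p (star (R c)) by apply: star_in_ultra; apply: pR; case: Ac.
have cRd : p [set H | forall d, d `<=` `I_n ->
    star (R c) d -> star (R c) (d `|` H)].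
  apply: filter_forall_subset => d _.
  have [Rd|nRd] := pselect (star (R c) d); last by apply: filterS filterT.
  by apply: filterS (star_shift Rd).
by apply: filterS (filterI (star_shift Ac) (filterI cR cRd)) => H [? [? ?]].
Qed.

Section Sequence.
Variables (F : nat -> set nat) (a : nat -> nat).
Hypotheses (a_mono : forall k, (a k <= a k.+1)%N).
Hypotheses (F_bound : forall k, F k `<=` `I_(a k.+1)).

Lemma bigcup_bound (E : set nat) n :
  E `<=` `I_n -> \bigcup_(k in E) F k `<=` `I_(a n).
Proof.
move=> En i [k /En /= kn /F_bound /= ia]; apply: leq_trans ia _.
exact: (homo_leq leqnn leq_trans a_mono).
Qed.

(** Finite unions of blocks are built from left to right, the greatest index
    last, so that the union d of the earlier blocks is below the bound a k. *)
Lemma bigcup_closed (Q : set (set nat)) K :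
  (forall k, (K <= k)%N -> Q (F k) /\
     forall d, d `<=` `I_(a k) -> Q d -> Q (d `|` F k)) ->
  forall E, nonempty_finite E -> (forall i, E i -> (K <= i)%N) ->
  Q (\bigcup_(k in E) F k).
Proof.
move=> QF E [E0 /finite_set_nat_bound[n En]]; elim: n E E0 En => [|n IHn] E E0 En KE.
  by have [i /En] := E0.
have En' : E `\ n `<=` `I_n.
  by move=> i [/En /=]; rewrite ltnS leq_eqVlt => /predU1P[].
have [nE|nE] := pselect (E n); last first.
  by apply: IHn => // i Ei; apply: En'; split => // ni; rewrite -ni in nE.
have [QFn QdFn] := QF _ (KE _ nE).
rewrite -(setD1K nE) bigcup_setU bigcup_set1 setUC.
have [E'0|E'0] := pselect (E `\ n !=set0); last first.
  suff -> : E `\ n = set0 by rewrite bigcup_set0 set0U.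
  by rewrite -subset0 => i Ei; apply: E'0; exists i.
apply: QdFn; first exact: bigcup_bound.
by apply: IHn => // i [Ei _]; exact: KE.
Qed.

Hypothesis F_block : forall k, block (a k) (F k).

Lemma block_unions (E : set nat) :
  nonempty_finite E -> star A (\bigcup_(k in E) F k).
Proof.
move=> E0; apply: (@bigcup_closed _ 0%N) => // k _.
have [AF cF] := F_block k; split => // d dk Ad.
by have [] := cF d dk Ad.
Qed.

(** With g the least element of G, the union c over E is below the bound a g. So
    the blocks from g on extend unions inside [star (R c)]. *)
Lemma block_unions2 (E G : set nat) : nonempty_finite E -> nonempty_finite G ->
  set_lt E G -> R (\bigcup_(k in E) F k) (\bigcup_(k in G) F k).
Proof.
move=> Ef Gf EG; set c := \bigcup_(k in E) F k.
have Ac : star A c by exact: block_unions.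
suff : star (R c) (\bigcup_(k in G) F k) by case.
have [g Gg gmin] : exists2 g, G g & forall i, G i -> (g <= i)%N.
  have [g0 /asboolP Gg0] := Gf.1.
  have [g /asboolP Gg gmin] := ex_minnP (ex_intro (fun i => `[< G i >]) g0 Gg0).
  by exists g => // i /asboolP; exact: gmin.
have cg : c `<=` `I_(a g) by apply: bigcup_bound => i Ei; exact: EG.
have cag k : (g <= k)%N -> c `<=` `I_(a k).
  move=> gk i /cg /= /leq_trans; apply.
  exact: (homo_leq leqnn leq_trans a_mono).
apply: (@bigcup_closed _ g) => // k gk; have [_ cF] := F_block k.
by have [] := cF c (cag k gk) Ac.
Qed.
End Sequence.

End Blocks.

(** * Beating a strategy in a Menger space *)

Section Game.
Variable X : topologicalType.
Hypothesis hX : menger_space X.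

Definition increasing_covers (C : nat -> nat -> set X) : Prop :=
  forall n, [/\ forall b, open (C n b),
    forall b b', (b <= b')%N -> C n b `<=` C n b' & forall x, exists b, C n b x].

(** A finite subfamily of an increasing cover lies in one of its members, so that
    Menger's property selects a function. *)
Lemma menger_choice (C : nat -> nat -> set X) : increasing_covers C ->
  exists f : nat -> nat, forall x, exists n, C n (f n) x.
Proof.
move=> incC.
have [|FF [FFC [_ FFT]]] := hX (U := fun n => range (C n)).
  move=> n; have [oC _ cC] := incC n; split.
    by apply: card_le_trans (card_image_le _ _) _; exact: countableP.
  split; first by move=> _ [b _ <-]; exact: oC.
  rewrite -subTset => x _; have [b Cx] := cC x.
  by exists (C n b) => //; exists b.
have /choice[f fP] n : exists b, \bigcup_(A in FF n) A `<=` C n b.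
  have [FFf FFr] := FFC n; have [_ C_mono _] := incC n.
  have /choice[g gP] : forall A, exists b, FF n A -> C n b = A.
    move=> A; have [/FFr[b _ Cb]|nA] := pselect (FF n A); last by exists 0%N.
    by exists b.
  have [b gb] := finite_set_nat_bound (finite_image g FFf).
  exists b => x [A FA Ax]; apply: (C_mono (g A)); last by rewrite gP.
  by apply: ltnW; apply: gb; exists A.
exists f => x; have : [set: X] x by [].
by rewrite -FFT => -[_ [n _ <-] Vx]; exists n; exact: fP.
Qed.

(** Apply the selection to each tail of the sequence of covers, and take at n
    the maximum of the finitely many functions obtained from the tails that
    contain n. *)
Lemma menger_infinitely_often (C : nat -> nat -> set X) : increasing_covers C ->
  exists f : nat -> nat, forall x N, exists2 n, (N <= n)%N & C n (f n) x.
Proof.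
move=> incC.
have /choice[f fP] N : exists f : nat -> nat, forall x, exists n, C (N + n)%N (f n) x.
  exact: (@menger_choice (fun n => C (N + n)%N)).
exists (fun n => \max_(N < n.+1) f N (n - N)) => x N.
have [n Cx] := fP N x; exists (N + n)%N; first exact: leq_addr.
have [_ C_mono _] := incC (N + n)%N; apply: C_mono Cx.
have Nn : (N < (N + n).+1)%N by rewrite ltnS leq_addr.
by apply: (bigmax_sup (Ordinal Nn)) => //=; rewrite addKn.
Qed.

Variables (W : nat -> nat -> set X) (phi : nat -> nat).
Hypotheses (Winc : increasing_covers W).
Hypothesis (Wdec : forall n n' b, (n <= n')%N -> W n' b `<=` W n b).

(** Let g_x n be the least b with x in W n b, and G_x = g_x o phi. Up to
    monotonicity, [chain i m b] is the set of points x for which the i-th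
    iterate of G_x maps m to a number at most b. *)
Fixpoint chain (i m b : nat) : set X :=
  if i is i'.+1 then \bigcup_l (W (phi m) l `&` chain i' l b)
  else [set x | (m <= b)%N].

Lemma chain_increasing_covers i : increasing_covers (chain i).
Proof.
elim: i => [|i IHi] m; split => /=.
- move=> b; have [mb|mb] := boolP (m <= b)%N.
    suff -> : [set _ : X | true] = setT by exact: openT.
    by rewrite -subTset.
  suff -> : [set _ : X | false] = set0 by exact: open0.
  by rewrite -subset0.
- by move=> b b' bb' x /= /leq_trans; exact.
- by move=> x; exists m.
- move=> b; apply: bigcup_open => l _; apply: openI.
    by have [] := Winc (phi m).
  by have [] := IHi l.
- move=> b b' bb' x [l _ [Wx Cx]]; exists l => //; split => //.
  by have [_ + _] := IHi l; apply; [exact: bb'|].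
- move=> x; have [_ _ /(_ x)[l Wx]] := Winc (phi m).
  have [_ _ /(_ x)[b Cx]] := IHi l.
  by exists b, l.
Qed.

(** If x is never caught from K on, then j k.+1 < G_x (j k) for all k >= K, and
    by monotonicity the i-th iterate of G_x at j K is at least j (K + i). *)
Lemma chain_overtaken (j : nat -> nat) x i K m b :
  (forall n n', (n <= n')%N -> (phi n <= phi n')%N) ->
  (j K <= m)%N -> chain i m b x -> (b < j (K + i))%N ->
  exists2 k, (K <= k)%N & W (phi (j k)) (j k.+1) x.
Proof.
move=> phi_mono; elim: i K m => [|i IHi] K m Km /=.
  by rewrite addn0 => mb bK; move: (leq_trans (leq_ltn_trans mb bK) Km); rewrite ltnn.
move=> [l _ [Wx Cx]]; rewrite addnS -addSn => bK.
have [lK|Kl] := leqP l (j K.+1).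
  exists K => //; apply: (Wdec (phi_mono _ _ Km)).
  by have [_ + _] := Winc (phi m); apply; [exact: lK|].
have [k Kk Wk] := IHi K.+1 l (ltnW Kl) Cx bK.
by exists k => //; exact: ltnW.
Qed.

End Game.

(** The special case of Hurewicz' theorem on the Menger game that is needed here.
    Here phi n bounds the next left end when n is the last right end. Choose f
    such that for each x, for infinitely many i, the i-th iterate of G_x maps i
    to at most f i. If j exceeds f, then no x can keep the iterates of G_x above
    j, which it would have to do in order to escape from some K on. *)
Theorem menger_right_ends (X : topologicalType) (hX : menger_space X)
    (W : nat -> nat -> set X) (phi : nat -> nat) :
  increasing_covers W ->
  (forall n n' b, (n <= n')%N -> W n' b `<=` W n b) ->
  exists f : nat -> nat, forall j : nat -> nat,
  (forall k, (f k < j k)%N) ->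
  forall x K, exists2 k, (K <= k)%N & W (phi (j k)) (j k.+1) x.
Proof.
(* psi is a nondecreasing majorant of phi; W (psi n) is contained in W (phi n). *)
move=> Winc Wdec; pose psi n := \max_(i < n.+1) phi i.
have psi_mono n n' : (n <= n')%N -> (psi n <= psi n')%N.
  move=> nn'; apply/bigmax_leqP => i _.
  have im : (i < n'.+1)%N by apply: leq_trans (ltn_ord i) _.
  exact: (bigmax_sup (Ordinal im)).
have [|f fP] := menger_infinitely_often hX (C := fun i => chain W psi i i).
  by move=> i; exact: chain_increasing_covers.
(* The maximum ensures that j (K + i) exceeds f i. *)
exists (fun k => \max_(i < k.+1) f i) => j fj x K.
have [i Ki Cx] := fP x (j K).
have iK : (i < (K + i).+1)%N by rewrite ltnS leq_addl.
have [|k Kk Wk] := chain_overtaken Winc Wdec psi_mono Ki Cx.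
  by apply: leq_ltn_trans (fj _); exact: (bigmax_sup (Ordinal iK)).
exists k => //; apply: Wdec Wk; exact: (bigmax_sup ord_max).
Qed.

(** * Large families of finite sets *)

Section Large.
Variable I : nat -> set nat.
Hypothesis I_dec : forall n n', (n <= n')%N -> I n' `<=` I n.
Hypothesis I_inf : forall n, infinite_set (I n).

Definition window (n m : nat) : set nat := [set i | I n i /\ (n <= i <= m)%N].

Definition fintail (n : nat) : set (set nat) :=
  [set F | nonempty_finite F /\ forall i, F i -> I n i /\ (n <= i)%N].

(** Members of B containing ever longer windows serve as substitutes for unions
    of finitely many members of B, which need not be in B. *)
Definition large (B : set (set nat)) : Prop :=
  exists n, forall m, exists2 F, B F & window n m `<=` F.

Lemma window_sub n n' m m' : (n <= n')%N -> (m' <= m)%N ->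
  window n' m' `<=` window n m.
Proof.
move=> nn' mm' i [Ii /andP[ni im]]; split; first exact: I_dec Ii.
by rewrite (leq_trans nn' ni) (leq_trans im mm').
Qed.

Lemma fintail_dec n n' : (n <= n')%N -> fintail n' `<=` fintail n.
Proof.
move=> nn' F [F0 Fn']; split => // i /Fn'[Ii ni]; split; first exact: I_dec Ii.
exact: leq_trans ni.
Qed.

Lemma large_sub B B' : B `<=` B' -> large B -> large B'.
Proof.
by move=> BB' [n nB]; exists n => m; have [F /BB'] := nB m; exists F.
Qed.

(** Partition regularity: windows increase with m, so that one failure for each
    half yields a common failure at the greater m. *)
Lemma large_setU B B' : large (B `|` B') -> large B \/ large B'.
Proof.
move=> [n nBB']; apply: contrapT => /not_orP[nB nB'].
have [m mB] : exists m, forall F, B F -> ~ (window n m `<=` F).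
  apply: contrapT => mP; apply: nB; exists n => m; apply: contrapT => FP.
  by apply: mP; exists m => F BF wF; apply: FP; exists F.
have [m' mB'] : exists m, forall F, B' F -> ~ (window n m `<=` F).
  apply: contrapT => mP; apply: nB'; exists n => m'; apply: contrapT => FP.
  by apply: mP; exists m' => F BF wF; apply: FP; exists F.
have [F [BF|B'F] wF] := nBB' (maxn m m').
  by apply: (mB F BF) => i /(window_sub (leqnn n) (leq_maxl m m'))/wF.
by apply: (mB' F B'F) => i /(window_sub (leqnn n) (leq_maxr m m'))/wF.
Qed.

Lemma infinite_ge n b : exists2 i, I n i & (b <= i)%N.
Proof.
apply: contrapT => nI; apply: (I_inf (n := n)).
apply: (sub_finite_set _ (finite_II b)) => i Ii /=.
by rewrite ltnNge; apply/negP => bi; apply: nI; exists i.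
Qed.

Lemma large_fintail n : large (fintail n).
Proof.
exists n => m; have [i Ii ni] := infinite_ge n n.
exists (window n (maxn m i)); last by apply: window_sub => //; exact: leq_maxl.
split; last by move=> k [Ik /andP[]].
split; first by exists i; rewrite /window /= ni leq_maxr.
apply: (sub_finite_set _ (finite_II (maxn m i).+1)) => k [_ /andP[_]].
by rewrite /= ltnS.
Qed.

(** An ultrafilter extends this filter if and only if it contains every
    [fintail n] and all of its members are large. *)
Definition colarge : set_system (set nat) :=
  [set A | exists n, ~ large (fintail n `\` A)].

Lemma colarge_fintail n : colarge (fintail n).
Proof. by exists n; rewrite setDv => -[k /(_ 0)[]]. Qed.

Lemma colarge_proper : ProperFilter colarge.
Proof.
split; first by move=> [n]; rewrite setD0; apply; exact: large_fintail.
split.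
- by exists 0; rewrite setDT => -[k /(_ 0)[]].
- move=> A B [n nA] [n' n'B]; exists (maxn n n') => lAB.
  have [] := @large_setU (fintail n `\` A) (fintail n' `\` B) _ => //.
  apply: large_sub lAB => F [Fn]; rewrite -[~ _]/((~` (A `&` B)) F) setCI => -[nAF|nBF].
    by left; split => //; apply: fintail_dec Fn; exact: leq_maxl.
  by right; split => //; apply: fintail_dec Fn; exact: leq_maxr.
- move=> A B AB [n nA]; exists n; apply: contra_not nA; apply: large_sub.
  by move=> F [Fn nBF]; split => // /AB.
Qed.

Lemma colarge_large (G : set_system (set nat)) B :
  ProperFilter G -> colarge `<=` G -> G B -> large B.
Proof.
move=> GG cG GB; apply: contrapT => nB; apply: (ultraNC GG GB); apply: cG.
by exists 0; apply: contra_not nB; apply: large_sub => F [_ /contrapT].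
Qed.

(** If a single t in [fintail n] can be followed by a large family of sets H with
    t `|` H outside A, then these unions form a large family outside A. *)
Lemma colarge_additive : additive_filter setU colarge.
Proof.
split; first exact: colarge_proper.
move=> G GU cG A [n nA]; exists n => -[k /(_ 0)[t [tn /= ntA] _]].
have GtA : G (setU t @^-1` (~` A) `&` fintail n).
  apply: filterI; last by apply: cG; exact: colarge_fintail.
  exact: (ultraC GU ntA).
have [m mP] := colarge_large _ cG GtA.
apply: nA; exists m => m'; have [H [tH Hn] wH] := mP m'.
exists (t `|` H); last by move=> i /wH; right.
split => //; split; last by move=> i [ti|Hi]; [exact: tn.2|exact: Hn.2].
split; last by rewrite finite_setU; split; [case: tn => -[]|case: Hn => -[]].
by have [[[i ti] _] _] := tn; exists i; left.
Qed.

End Large.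

Lemma ultra_pigeonhole (T : Type) (p : set_system T) (A : set T) (f : T -> nat) k :
  UltraFilter p -> p A -> (forall x, A x -> (f x <= k)%N) ->
  exists c, p [set x | A x /\ f x = c].
Proof.
move=> pU; elim: k A => [|k IHk] A pA fk.
  exists 0; apply: filterS pA => x Ax; split => //.
  by apply/eqP; rewrite -leqn0; exact: fk.
have [|npk] := pselect (p [set x | A x /\ f x = k.+1]); first by exists k.+1.
have [|x [Ax nfx]|c pc] := IHk (A `&` [set x | f x <> k.+1]).
- apply: filterS (filterI pA (ultraC pU npk)) => x [Ax nx]; split => // fx.
  exact: nx.
- by have := fk x Ax; rewrite leq_eqVlt => /predU1P[].
- by exists c; apply: filterS pc => x [[]].
Qed.

Lemma card_pair (T : Type) (a b : T) : a <> b -> ([set a; b] #= `I_2)%card.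
Proof.
move=> ab; pose g i := if i is 0 then a else b.
have -> : [set a; b] = g @` `I_2.
  apply/seteqP; split => [x [->|->]|_ [[|i] _ <-]].
  - by exists 0.
  - by exists 1.
  - by left.
  - by right.
apply: inj_card_eq => i i'; rewrite !inE /=.
case: i i' => [|[|i]] [|[|i']] //= _ _ eq_ab; by case: ab.
Qed.

(** * The selection *)

Lemma subset_bigcupI (T : Type) (V : nat -> set T) (F G : set nat) :
  F `<=` G -> \bigcup_(i in F) V i `<=` \bigcup_(i in G) V i.
Proof. by move=> FG x [i Fi Vx]; exists i => //; exact: FG. Qed.

Section Selection.
Variables (X : topologicalType) (U : nat -> set (set X)) (u : nat -> set X).
Hypothesis hX : menger_space X.
Hypothesis U_dec : forall n, U n.+1 `<=` U n.
Hypothesis U_cover : forall n, open_cover (U n).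
Hypothesis U_inf : forall n, point_infinite (U n).
Hypothesis U_fin : forall n, ~ has_finite_subcover (U n).
Hypotheses (u_inj : injective u) (u_range : range u = U 0).

Lemma U_mono n n' : (n <= n')%N -> U n' `<=` U n.
Proof.
exact: (homo_leq (r := fun A B => B `<=` A) (@subset_refl _)
  (fun B A C AB BC => subset_trans BC AB) U_dec).
Qed.

Lemma u_open i : open (u i).
Proof. by have [+ _] := U_cover 0; apply; rewrite -u_range; exists i. Qed.

Lemma u_surj n A : U n A -> exists2 i, U n (u i) & u i = A.
Proof.
move=> UA; have : U 0 A by exact: U_mono UA.
by rewrite -u_range => -[i _ uA]; exists i; rewrite // uA.
Qed.

Definition index_set n : set nat := [set i | U n (u i)].

Lemma index_dec n n' : (n <= n')%N -> index_set n' `<=` index_set n.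
Proof. by move=> nn' i; exact: U_mono. Qed.

(** Otherwise U n is finite and is a finite subcover of itself. *)
Lemma index_inf n : infinite_set (index_set n).
Proof.
move=> If; apply: (U_fin (n := n)); exists (U n); split => //; last first.
  by have [] := U_cover n.
apply: sub_finite_set (finite_image u If) => A /u_surj[i Ui <-].
by exists i.
Qed.

Definition open_union (F : set nat) : set X := \bigcup_(i in F) u i.

Lemma union_open F : open (open_union F).
Proof. by apply: bigcup_open => i _; exact: u_open. Qed.

Lemma union_finite F : finite_set F -> open_union F <> setT.
Proof.
move=> Ff FT; apply: (U_fin (n := 0)); exists (u @` F); split.
- exact: finite_image.
- by move=> _ [i _ <-]; rewrite -u_range; exists i.
- by rewrite bigcup_image.
Qed.

Lemma window_covers : increasing_covers (fun n b => open_union (window index_set n b)).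
Proof.
move=> n; split.
- by move=> b; exact: union_open.
- move=> b b' bb'; apply: subset_bigcupI; apply: window_sub => //.
  exact: index_dec.
- move=> x; apply: contrapT => nb; apply: (@U_inf n x).
  apply: sub_finite_set (finite_image u (finite_II n)).
  move=> A [/u_surj[i Ui uA]]; rewrite -uA => ux.
  exists i => //=; rewrite ltnNge; apply/negP => ni.
  by apply: nb; exists i; exists i => //; split => //; rewrite ni leqnn.
Qed.

Variables (k : nat) (chi1 : set X -> nat) (chi2 : set (set X) -> nat).
Hypothesis chi1P : coloring k (open : set (set X)) chi1.
Hypothesis chi2P : coloring k (two_subsets (open : set (set X))) chi2.

(** The value 0, which chi2 does not take on pairs of open sets, records that the
    two unions coincide. *)
Definition pair_color (F G : set nat) : nat :=
  if pselect (open_union F = open_union G) then 0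
  else chi2 [set open_union F; open_union G].

Lemma pair_color_le F G : (pair_color F G <= k)%N.
Proof.
rewrite /pair_color; case: pselect => //= FG.
have /andP[//] : (1 <= chi2 [set open_union F; open_union G] <= k)%N.
apply: chi2P; split; last exact: card_pair.
by move=> _ [->|->]; exact: union_open.
Qed.

Lemma pair_color0 F G : pair_color F G = 0 -> open_union F = open_union G.
Proof.
rewrite /pair_color; case: pselect => //= FG chi0.
have /andP[] : (1 <= chi2 [set open_union F; open_union G] <= k)%N.
  apply: chi2P; split; last exact: card_pair.
  by move=> _ [->|->]; exact: union_open.
by rewrite chi0.
Qed.

Lemma ex_homogeneous (p : set_system (set nat)) : UltraFilter p ->
  exists c1 c2, p [set F | chi1 (open_union F) = c1 /\ p [set G | pair_color F G = c2]].
Proof.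
move=> pU.
have [c1 pc1] : exists c1, p [set F | setT F /\ chi1 (open_union F) = c1].
  apply: (ultra_pigeonhole (k := k)) => [|F _]; first exact: filterT.
  by have /andP[] := chi1P (union_open F).
have /choice[c2 pc2] F : exists c, p [set G | setT G /\ pair_color F G = c].
  apply: (ultra_pigeonhole (k := k)) => [|G _]; first exact: filterT.
  exact: pair_color_le.
have [F _|c pc] := ultra_pigeonhole (k := k) (f := c2) pU pc1.
  have [G [_ <-]] := @filter_ex _ p _ _ (pc2 F); exact: pair_color_le.
exists c1, c; apply: (@filterS _ p) pc => F [[_ Fc1] <-]; split => //.
by apply: (@filterS _ p) (pc2 F) => G [].
Qed.

(** The play. Here a n is the bound of the blocks before the n-th one, N (a n)
    the left end of the n-th window and j n its right end. The strategy consists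
    of S, which picks a block containing the window, and of h, which bounds this
    block. *)
Lemma ex_block_sequence : exists F : nat -> set nat,
  [/\ forall n, fintail index_set n (F n),
      forall m n, (m < n)%N -> set_lt (F m) (F n),
      forall x K, exists2 n, (K <= n)%N & open_union (F n) x &
      exists c1 c2,
        (forall E, nonempty_finite E -> chi1 (open_union (\bigcup_(n in E) F n)) = c1) /\
        (forall E G, nonempty_finite E -> nonempty_finite G -> set_lt E G ->
          pair_color (\bigcup_(n in E) F n) (\bigcup_(n in G) F n) = c2)].
Proof.
have [p [pU cp pI]] := ex_idempotent_ultrafilter (@setUA nat)
  (colarge_additive index_dec index_inf).
have p_large B : p B -> large index_set B by exact: colarge_large.
have [c1 [c2 pA]] := ex_homogeneous pU.
set A := [set F | _] in pA; pose R F := [set G | pair_color F G = c2].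
have pR F : A F -> p (R F) by case.
pose B n := block p A R n `&` fintail index_set n.
have pB n : p (B n).
  by apply: filterI; [exact: block_mem|apply: cp; exact: colarge_fintail].
have /choice[N NP] n : exists N, forall m, exists F,
    B n F /\ window index_set N m `<=` F.
  have [N NP] := p_large _ (pB n).
  by exists N => m; have [F] := NP m; exists F.
have /choice[S SP] n : exists S : nat -> set nat, forall m,
    B n (S m) /\ window index_set (N n) m `<=` S m.
  by have /choice[S SP] := NP n; exists S.
have /choice[h hP] n : exists h : nat -> nat, forall m, S n m `<=` `I_(h m).
  suff /choice[h hP] : forall m, exists b, S n m `<=` `I_b by exists h.
  move=> m; apply: finite_set_nat_bound.
  by have [[_ [[]]]] := SP n m.
(* Requiring a n <= j n makes the maximum over a <= b bound the next left end. *)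
have [f fP] := menger_right_ends hX (fun b => \max_(a < b.+1) N (h a b))
  window_covers (fun n n' b nn' => subset_bigcupI (window_sub index_dec nn' (leqnn b))).
pose a := fix a n := if n is n'.+1
  then h (a n') (maxn (f n').+1 (a n')) else 0.
pose j n := maxn (f n).+1 (a n).
pose F n := S (a n) (j n).
have aS n : a n.+1 = h (a n) (j n) by [].
have FB n : B (a n) (F n) by have [] := SP (a n) (j n).
have Fa n : F n `<=` `I_(a n.+1) by exact: hP.
have aF n i : F n i -> (a n <= i)%N by have [_ [_ Fn] /Fn[]] := FB n.
have a_lt n : (a n < a n.+1)%N.
  have [_ [[[i Fi] _] _]] := FB n.
  exact: leq_ltn_trans (aF _ _ Fi) (Fa _ _ Fi).
have a_mono n : (a n <= a n.+1)%N by exact: ltnW.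
have na n : (n <= a n)%N.
  by elim: n => // n /leq_ltn_trans; apply; exact: a_lt.
exists F; split.
- move=> n; apply: (fintail_dec index_dec (na n)); by have [] := FB n.
- move=> m n mn i i' /Fa /= ia /aF; apply: leq_trans; apply: leq_trans ia _.
  exact: (@homo_leq _ a leq leqnn leq_trans a_mono _ _ mn).
- move=> x K; have fj n : (f n < j n)%N by exact: leq_maxl.
  have [n Kn Wx] := fP j fj x K.
  exists n.+1; first exact: leqW.
  have [_ wF] := SP (a n.+1) (j n.+1); apply: subset_bigcupI wF _ _.
  apply: subset_bigcupI Wx; apply: window_sub => //; first exact: index_dec.
  have aj : (a n < (j n).+1)%N by rewrite ltnS leq_maxr.
  by rewrite aS; exact: (bigmax_sup (Ordinal aj)).
have FBl n : block p A R (a n) (F n) by have [] := FB n.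
exists c1, c2; split => [E Ef|E G Ef Gf EG].
  by have [[]] := block_unions a_mono Fa FBl Ef.
exact: (block_unions2 a_mono Fa FBl).
Qed.

Lemma enumerated_selection : exists FF : nat -> set (set X),
  [/\ finite_selection U FF,
      ramsey_properties chi1 chi2 (fun n => \bigcup_(A in FF n) A) &
      forall n, set_lt [set m | FF n (u m)] [set m | FF n.+1 (u m)]].
Proof.
have [F [Ftail Flt Fcover [c1 [c2 [Fc1 Fc2]]]]] := ex_block_sequence.
pose FF n := u @` F n; exists FF.
have VF E : \bigcup_(n in E) \bigcup_(A in FF n) A =
    open_union (\bigcup_(n in E) F n).
  rewrite /open_union bigcup_bigcup; apply: eq_bigcupr => n _.
  exact: bigcup_image.
have VF1 n : \bigcup_(A in FF n) A = open_union (F n) by exact: bigcup_image.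
have one n : nonempty_finite [set n].
  by split; [exists n|exact: finite_set1].
(* Otherwise all the unions coincide, and each point is in some of them. *)
have c2_neq0 : c2 <> 0.
  move=> c20; have /union_finite : finite_set (F 0) by have [[]] := Ftail 0.
  apply; rewrite -subTset => x _; have [[//|n] _ Vx] := Fcover x 1.
  have := Fc2 [set 0] [set n.+1] (one _) (one _).
  rewrite !bigcup_set1 c20 => /(_ _)/pair_color0 -> //.
  by move=> _ _ -> ->.
have F_neq E G : nonempty_finite E -> nonempty_finite G -> set_lt E G ->
    open_union (\bigcup_(n in E) F n) <> open_union (\bigcup_(n in G) F n).
  move=> Ef Gf EG eq_EG; apply: c2_neq0; rewrite -(Fc2 E G) // /pair_color.
  by case: pselect.
have uF n i : FF n (u i) -> F n i by move=> [i' Fi /u_inj <-].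
split.
- split.
    move=> n; have [[[i Fi] Ff] Fn] := Ftail n; split.
    + by exists (u i), i.
    + exact: finite_image.
    + by move=> _ [i' /Fn[]] Ui' _ <-.
  move=> m n mn; rewrite -subset0 => _ [[i Fi <-] /uF Fi'].
  have [lt|lt|//] := ltngtP m n.
    by have := Flt _ _ lt _ _ Fi Fi'; rewrite ltnn.
  by have := Flt _ _ lt _ _ Fi' Fi; rewrite ltnn.
- have -> : (fun n => \bigcup_(A in FF n) A) = open_union \o F by exact: funext.
  have VE E : \bigcup_(n in E) (open_union \o F) n = open_union (\bigcup_(n in E) F n).
    by rewrite -VF; apply: eq_bigcupr => n _; rewrite VF1.
  split.
  + split.
      split; first by move=> _ [n _ <-]; exact: union_open.
      rewrite -subTset => x _; have [n _ Vx] := Fcover x 0.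
      by exists (open_union (F n)) => //; exists n.
    move=> x; have V_inj : injective (open_union \o F).
      move=> m n /= eq_mn; apply: contrapT => mn.
      have [lt|lt|//] := ltngtP m n.
        by apply: (F_neq [set m] [set n]); rewrite ?bigcup_set1 // => _ _ -> ->.
      by apply: (F_neq [set n] [set m]); rewrite ?bigcup_set1 // => _ _ -> ->.
    have inf_x : infinite_set [set n | open_union (F n) x].
      move=> /finite_set_nat_bound[b xb]; have [n bn /xb /=] := Fcover x b.
      by rewrite ltnNge bn.
    apply: sub_infinite_set (_ : infinite_set ((open_union \o F) @` [set n | open_union (F n) x])).
      by move=> _ [n xn <-]; split => //; exists n.
    by rewrite (eq_finite_set (inj_card_eq _)) // => m n _ _ /V_inj.
  + by move=> E G Ef Gf EG; rewrite !VE; exact: F_neq.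
  + by exists c1 => E Ef; rewrite VE; exact: Fc1.
  + exists c2 => E G Ef Gf EG; rewrite !VE -(Fc2 E G) // /pair_color.
    by case: pselect => //= /F_neq; case.
- by move=> n i i' /uF Fi /uF Fi'; exact: (Flt n n.+1).
Qed.

End Selection.

Lemma ex_enumeration (T : pointedType) (A : set T) :
  countable A -> infinite_set A -> exists u : nat -> T, injective u /\ range u = A.
Proof.
move=> cA iA; have /card_esym/card_set_bijP[u [uA u_inj u_surj]] := eq_card_nat cA iA.
exists u; split; first by move=> i j; apply: u_inj; rewrite inE.
by apply/seteqP; split => // _ [i _ <-]; exact: uA.
Qed.

Unset Implicit Arguments.
Set Strict Implicit.

Theorem theorem4p6 (X : topologicalType) (hX : menger_space X)
    (U : nat -> set (set X))
    (hdecr : forall n, U n.+1 `<=` U n)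
    (hcount : forall n, countable (U n))
    (hcover : forall n, open_cover (U n))
    (hinf : forall n, point_infinite (U n))
    (hfin : forall n, ~ has_finite_subcover (U n))
    (k : nat)
    (chi1 : set X -> nat)
    (hchi1 : coloring k (open : set (set X)) chi1)
    (chi2 : set (set X) -> nat)
    (hchi2 : coloring k (two_subsets (open : set (set X))) chi2) :
  (exists FF : nat -> set (set X),
     finite_selection U FF /\
     ramsey_properties chi1 chi2 (fun n => \bigcup_(A in FF n) A)) /\
  (forall u : nat -> set X, injective u -> range u = U 0%N ->
   exists FF : nat -> set (set X),
     [/\ finite_selection U FF,
         ramsey_properties chi1 chi2 (fun n => \bigcup_(A in FF n) A) &
         forall n, set_lt [set m | FF n (u m)] [set m | FF n.+1 (u m)]]).
Proof.
have selection u : injective u -> range u = U 0%N -> _ :=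
  fun inj ran => enumerated_selection hX hdecr hcover hinf hfin inj ran hchi1 hchi2.
split=> //.
have U0_inf : infinite_set (U 0%N).
  by move=> Uf; apply: (hfin 0%N); exists (U 0%N); split => //; have [] := hcover 0%N.
have [u [u_inj u_range]] := ex_enumeration (hcount 0%N) U0_inf.
by have [FF [selFF ramFF _]] := selection u u_inj u_range; exists FF.
Qed.
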